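(* Let $\mathcal H$ be a coquasitriangular Hopf algebra over $\mathbf C$ with universal $r$-form $r$, and let $\mathcal X\subset\mathcal H$ be a subalgebra and left coideal (i.e. $\Delta(\mathcal X)\subset\mathcal H\otimes\mathcal X$) having the following property: whenever $(x_{ij})$ and $(y_{ij})$ are square matrices indexed by a finite set with $x_{ij}\in\mathcal X$, $y_{ij}\in\mathcal H$ and $\sum_k x_{ik}y_{kj}=\delta_{ij}1=\sum_k y_{ik}x_{kj}$ for all $i,j$, then $y_{ij}\in\mathcal X$ for all $i,j$. Let $e^1,\dots,e^M\in\mathcal X$ with $\Delta(e^i)=\sum_j\pi^i_j\otimes e^j$, and let $b^1,\dots,b^M\in\mathcal X$ with $\Delta(b^i)=\sum_j\psi^i_j\otimes b^j$, where $\pi^i_j,\psi^i_j\in\mathcal H$. Let $\nu$ be an algebra endomorphism of $\mathcal X$ which is covariant, i.e. $\Delta\circ\nu=(\mathrm{id}\otimes\nu)\circ\Delta$ on $\mathcal X$. For $a\in\mathcal X$ let $$\chi^i(a)=r(b^i\otimes\nu(a))-\varepsilon(b^i)\,\varepsilon(a),\qquad i=1,\dots,M,$$ and suppose that the matrix $\chi=(\chi^{ij})_{i,j=1}^M$ with $\chi^{ij}=\chi^i(e^j)$ is invertible. Then there exists, uniquely up to isomorphism, a covariant first order differential calculus $(\Gamma,\mathrm d)$ on $\mathcal X$ such that (i) for every $a\in\mathcal X$ there are unique $a_1,\dots,a_M\in\mathcal X$ with $\mathrm da=\sum_i a_i\,\mathrm de^i$, and (ii) these coefficients are given by $$\mathrm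 da=\sum_i\partial_i(a)\,\mathrm de^i,\qquad \partial_i(a)=\sum_{j,k}a_{(1)}\,\chi^k(a_{(2)})\,(\chi^{-1})_{jk}\,S(\pi^j_i).$$ Moreover, this calculus satisfies $\mathrm da=\omega a-a\omega$ for all $a\in\mathcal X$, where $$\omega=\sum_i\omega_i\,\mathrm de^i,\qquad \omega_i=\sum_{j,k}\varepsilon(b^k)\,(\chi^{-1})_{jk}\,S(\pi^j_i)\in\mathcal X.$$
   Context: Algebras, subalgebras and algebra homomorphisms are unital. $\mathcal H$ has comultiplication $\Delta$, counit $\varepsilon$, antipode $S$; Sweedler notation $\Delta(a)=a_{(1)}\otimes a_{(2)}$ is used. A Hopf algebra $\mathcal H$ is coquasitriangular if it is equipped with a linear map $r:\mathcal H\otimes\mathcal H\to\mathbf C$ (universal $r$-form) such that for all $a,b,c\in\mathcal H$: $r(a_{(1)}\otimes b_{(1)})\,a_{(2)}b_{(2)}=b_{(1)}a_{(1)}\,r(a_{(2)}\otimes b_{(2)})$; $r(ab\otimes c)=r(a\otimes c_{(1)})\,r(b\otimes c_{(2)})$, $r(1\otimes c)=\varepsilon(c)$; $r(a\otimes bc)=r(a_{(1)}\otimes c)\,r(a_{(2)}\otimes b)$, $r(a\otimes1)=\varepsilon(a)$. (Then $\bar r=r\circ(S\otimes\mathrm{id})$ is a two-sided convolution inverse of $r$, and $S$ is bijective.) A first order differential calculus on $\mathcal X$ is a pair $(\Gamma,\mathrm d)$ of an $\mathcal X$-bimodule $\Gamma$ and a linear map $\mathrm d:\mathcal X\to\Gamma$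 with $\mathrm d(ab)=\mathrm da\,b+a\,\mathrm db$ and $\Gamma=\mathrm{Lin}\{a\,\mathrm db\mid a,b\in\mathcal X\}$. It is covariant if the linear map $\Delta_\Gamma:\Gamma\to\mathcal H\otimes\Gamma$, $a\,\mathrm db\mapsto a_{(1)}b_{(1)}\otimes a_{(2)}\,\mathrm db_{(2)}$, is well-defined. Calculi $(\Gamma,\mathrm d)$, $(\Gamma',\mathrm d')$ are isomorphic if there is a bimodule isomorphism $\Gamma\to\Gamma'$ sending $\mathrm da$ to $\mathrm d'a$ for all $a$. The entries of $\chi^{-1}$ are indexed so that $\sum_k(\chi^{-1})_{jk}\chi^{kl}=\delta_{jl}$. *)

(* Defs.v *)
From HB Require Import structures.
From mathcomp Require Import all_boot all_order all_algebra generic_quotient.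
From mathcomp Require Import sesquilinear complex boolp reals.

Set Implicit Arguments.
Unset Strict Implicit.
Unset Printing Implicit Defensive.

Import GRing.Theory.
Local Open Scope ring_scope.
Local Open Scope quotient_scope.

Section Tensor.
Variables (K : fieldType) (V W : lmodType K).

(* The sequence [:: (v1, w1); ...; (vn, wn)] stands for the formal sum
   v1 ⊗ w1 + ... + vn ⊗ wn. A scalar multiple k (v ⊗ w) is encoded by
   (k v) ⊗ w, so that formal sums need no coefficients. *)
Inductive tensor_eq : seq (V * W) -> seq (V * W) -> Prop :=
| TensorRefl s : tensor_eq s s
| TensorSym s t : tensor_eq s t -> tensor_eq t s
| TensorTrans s t u : tensor_eq s t -> tensor_eq t u -> tensor_eq s u
| TensorCat s s' t t' :
    tensor_eq s s' -> tensor_eq t t' -> tensor_eq (s ++ t) (s' ++ t')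
| TensorCatC s t : tensor_eq (s ++ t) (t ++ s)
| TensorDl v v' w : tensor_eq [:: (v + v', w)] [:: (v, w); (v', w)]
| TensorDr v w w' : tensor_eq [:: (v, w + w')] [:: (v, w); (v, w')]
| TensorZ k v w : tensor_eq [:: (k *: v, w)] [:: (v, k *: w)]
| Tensor0 w : tensor_eq [:: (0, w)] [::].

Definition tensor_rel (s t : seq (V * W)) : bool := `[< tensor_eq s t >].

Fact tensor_rel_refl : reflexive tensor_rel.
Proof. by move=> s; apply/asboolP; apply: TensorRefl. Qed.

Fact tensor_rel_sym : symmetric tensor_rel.
Proof. by move=> s t; apply/asboolP/asboolP; apply: TensorSym. Qed.

Fact tensor_rel_trans : transitive tensor_rel.
Proof.
by move=> t s u /asboolP st /asboolP tu; apply/asboolP; apply: TensorTrans tu.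
Qed.

Canonical tensor_equiv :=
  EquivRel tensor_rel tensor_rel_refl tensor_rel_sym tensor_rel_trans.

Definition tensor : Type := {eq_quot tensor_equiv}.
HB.instance Definition _ := EqQuotient.on tensor.
HB.instance Definition _ := Choice.on tensor.

Lemma tensorP (s t : seq (V * W)) :
  (\pi_tensor s = \pi_tensor t) <-> tensor_eq s t.
Proof.
split; first by move=> /eqmodP /asboolP.
by move=> st; apply/eqmodP/asboolP.
Qed.

Lemma tensor_reprK (s : seq (V * W)) : tensor_eq (repr (\pi_tensor s)) s.
Proof. by apply/tensorP; rewrite reprK. Qed.

Definition tensor_pure (v : V) (w : W) : tensor := \pi_tensor [:: (v, w)].
Definition tensor_zero : tensor := \pi_tensor [::].
Definition tensor_add (s t : tensor) : tensor :=
  \pi_tensor (repr s ++ repr t).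
Definition tensor_scale (k : K) (s : tensor) : tensor :=
  \pi_tensor [seq (k *: p.1, p.2) | p <- repr s].
Definition tensor_opp (s : tensor) : tensor := tensor_scale (-1) s.

Let sc (k : K) (s : seq (V * W)) := [seq (k *: p.1, p.2) | p <- s].

Lemma tensor_eq_scale k s t : tensor_eq s t -> tensor_eq (sc k s) (sc k t).
Proof.
elim=> {s t}.
- by move=> s; apply: TensorRefl.
- by move=> s t _; apply: TensorSym.
- by move=> s t u _ st _; apply: TensorTrans.
- by move=> s s' t t' _ ss' _ tt'; rewrite /sc !map_cat; apply: TensorCat.
- by move=> s t; rewrite /sc !map_cat; apply: TensorCatC.
- by move=> v v' w /=; rewrite scalerDr; apply: TensorDl.
- by move=> v w w'; apply: TensorDr.
- move=> l v w; rewrite /= scalerA mulrC -scalerA; exact: TensorZ.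
- by move=> w; rewrite /= scaler0; apply: Tensor0.
Qed.

Lemma tensor_add_pi s t :
  tensor_add (\pi s) (\pi t) = \pi_tensor (s ++ t).
Proof. by apply/tensorP; apply: TensorCat; apply: tensor_reprK. Qed.

Lemma tensor_scale_pi k s : tensor_scale k (\pi s) = \pi_tensor (sc k s).
Proof. by apply/tensorP; apply: tensor_eq_scale; apply: tensor_reprK. Qed.

Fact tensor_addA : associative tensor_add.
Proof.
move=> x y z; rewrite -[x]reprK -[y]reprK -[z]reprK.
by rewrite !tensor_add_pi catA.
Qed.

Fact tensor_addC : commutative tensor_add.
Proof. by move=> x y; apply/tensorP; apply: TensorCatC. Qed.

Fact tensor_add0 : left_id tensor_zero tensor_add.
Proof. by move=> x; rewrite -[x]reprK tensor_add_pi. Qed.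

Lemma tensor_eqD k l s : tensor_eq (sc (k + l) s) (sc k s ++ sc l s).
Proof.
elim: s => [|[v w] s IH] /=; first exact: TensorRefl.
have h : tensor_eq ((((k + l) *: v, w) :: nil) ++ sc (k + l) s)
    ([:: (k *: v, w); (l *: v, w)] ++ (sc k s ++ sc l s)).
  by apply: TensorCat => //; rewrite scalerDl; apply: TensorDl.
apply: TensorTrans h _.
apply: (@TensorCat [:: (k *: v, w)] [:: (k *: v, w)] ((l *: v, w) :: _));
  first exact: TensorRefl.
rewrite -cat_rcons -(cat1s (l *: v, w)) catA -cats1.
by apply: TensorCat; [apply: TensorCatC | apply: TensorRefl].
Qed.

Lemma tensor_eq_sc0 s : tensor_eq (sc 0 s) [::].
Proof.
elim: s => [|[v w] s IH] /=; first exact: TensorRefl.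
apply: (@TensorCat [:: (0 *: v, w)] [::]) => //.
by rewrite scale0r; apply: Tensor0.
Qed.

Lemma sc1 s : sc 1 s = s.
Proof. by elim: s => [|[v w] s IH] //=; rewrite scale1r IH. Qed.

Fact tensor_addN : left_inverse tensor_zero tensor_opp tensor_add.
Proof.
move=> x; rewrite -[x]reprK /tensor_opp tensor_scale_pi tensor_add_pi.
apply/tensorP; rewrite -[X in _ ++ X]sc1.
apply: TensorTrans (TensorSym (tensor_eqD _ _ _)) _.
by rewrite addNr; apply: tensor_eq_sc0.
Qed.

HB.instance Definition _ :=
  GRing.isZmodule.Build tensor tensor_addA tensor_addC tensor_add0 tensor_addN.

Fact tensor_scaleA k l (x : tensor) :
  tensor_scale k (tensor_scale l x) = tensor_scale (k * l) x.
Proof.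
rewrite -[x]reprK !tensor_scale_pi /sc -map_comp.
by congr \pi; apply: eq_map => p /=; rewrite scalerA.
Qed.

Fact tensor_scale1 : left_id 1 tensor_scale.
Proof. by move=> x; rewrite -[x]reprK tensor_scale_pi sc1. Qed.

Fact tensor_scaleDr : right_distributive tensor_scale +%R.
Proof.
move=> k x y; rewrite -[x]reprK -[y]reprK.
rewrite -![_ + _]/(tensor_add _ _).
by rewrite tensor_add_pi !tensor_scale_pi tensor_add_pi /sc map_cat.
Qed.

Fact tensor_scaleDl (x : tensor) :
  {morph tensor_scale^~ x : k l / k + l}.
Proof.
move=> k l; rewrite -[x]reprK -[RHS]/(tensor_add _ _).
rewrite !tensor_scale_pi tensor_add_pi.
by apply/tensorP; apply: tensor_eqD.
Qed.

HB.instance Definition _ := GRing.Zmodule_isLmodule.Build K tensor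
  tensor_scaleA tensor_scale1 tensor_scaleDr tensor_scaleDl.

(* The value at t = v1 ⊗ w1 + ... + vn ⊗ wn of the map induced by f; it is
   independent of the chosen representative when f is bilinear, see
   tensor_lift_pi. *)
Definition tensor_lift (U : zmodType) (f : V -> W -> U) (t : tensor) : U :=
  \sum_(p <- repr t) f p.1 p.2.

End Tensor.

Notation "v ⊗ w" := (tensor_pure v w)
  (at level 40, left associativity) : ring_scope.

(* Sweedler notation: \sw_(a1, a2 <- comul a) F a1 a2 is F(a_(1), a_(2)). *)
Notation "\sw_ ( x , y <- t ) F" := (tensor_lift (fun x y => F) t)
  (at level 36, F at level 36, x name, y name, t at level 50,
   format "\sw_ ( x ,  y  <-  t )  F") : ring_scope.

Section TensorLift.
Variables (K : fieldType) (V W U : lmodType K) (f : V -> W -> U).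
Hypothesis f_bilinear : bilinear_for *:%R *:%R f.

Let fDl v v' w : f (v + v') w = f v w + f v' w.
Proof. by have := f_bilinear.1 w 1 v v'; rewrite /= !scale1r. Qed.
Let fDr v w w' : f v (w + w') = f v w + f v w'.
Proof. by have := f_bilinear.2 v 1 w w'; rewrite /= !scale1r. Qed.
Let f0l w : f 0 w = 0.
Proof. by apply: (addrI (f 0 w)); rewrite -fDl !addr0. Qed.
Let f0r v : f v 0 = 0.
Proof. by apply: (addrI (f v 0)); rewrite -fDr !addr0. Qed.
Let fZl k v w : f (k *: v) w = k *: f v w.
Proof. by have := f_bilinear.1 w k v 0; rewrite /= f0l !addr0. Qed.
Let fZr k v w : f v (k *: w) = k *: f v w.
Proof. by have := f_bilinear.2 v k w 0; rewrite /= f0r !addr0. Qed.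

Lemma tensor_eq_sum (s t : seq (V * W)) : tensor_eq s t ->
  \sum_(p <- s) f p.1 p.2 = \sum_(p <- t) f p.1 p.2.
Proof.
elim=> {s t} //.
- by move=> s t u _ -> _ ->.
- by move=> s s' t t' _ ss' _ tt'; rewrite !big_cat /= ss' tt'.
- by move=> s t; rewrite !big_cat /= addrC.
- by move=> v v' w; rewrite !big_cons !big_nil /= !addr0 fDl.
- by move=> v w w'; rewrite !big_cons !big_nil /= !addr0 fDr.
- by move=> k v w; rewrite !big_cons !big_nil /= fZl fZr.
- by move=> w; rewrite !big_cons !big_nil /= f0l addr0.
Qed.

Lemma tensor_lift_pi (s : seq (V * W)) :
  tensor_lift f (\pi_(tensor V W) s) = \sum_(p <- s) f p.1 p.2.
Proof. by apply: tensor_eq_sum; apply: tensor_reprK. Qed.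

Lemma tensor_lift_pure v w : tensor_lift f (v ⊗ w) = f v w.
Proof. by rewrite tensor_lift_pi big_seq1. Qed.

Lemma tensor_lift_is_linear : linear (tensor_lift f).
Proof.
move=> k x y; rewrite -[x]reprK -[y]reprK.
rewrite -[_ + _]/(tensor_add (tensor_scale _ _) _).
rewrite tensor_scale_pi tensor_add_pi !tensor_lift_pi big_cat big_map /=.
by rewrite scaler_sumr; congr (_ + _); apply: eq_bigr => p _; rewrite fZl.
Qed.

End TensorLift.

Lemma tensor_pure_bilinear (K : fieldType) (V W : lmodType K) :
  bilinear_for *:%R *:%R (@tensor_pure K V W).
Proof.
split=> [w|v] k.
  move=> v v'; rewrite -[RHS]/(tensor_add (tensor_scale _ _) _).
  by rewrite tensor_scale_pi tensor_add_pi; apply/tensorP; apply: TensorDl.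
move=> w w'; rewrite -[RHS]/(tensor_add (tensor_scale _ _) _).
rewrite tensor_scale_pi tensor_add_pi; apply/tensorP.
apply: TensorTrans (TensorDr _ _ _) _.
apply: (@TensorCat _ _ _ [:: (v, k *: w)] _ [:: (v, w')]).
  by apply: TensorSym; apply: TensorZ.
exact: TensorRefl.
Qed.

Lemma tensor_sumE (K : fieldType) (V W : lmodType K) (t : tensor V W) :
  t = \sw_(v, w <- t) (v ⊗ w).
Proof.
rewrite -[t in LHS]reprK /tensor_lift; elim: (repr t) => [|[v w] s IH].
  by rewrite big_nil.
by rewrite big_cons -IH -[RHS]/(tensor_add _ _) tensor_add_pi.
Qed.

HB.mixin Record isHopf (K : fieldType) H of GRing.Algebra K H := {
  comul : {linear H -> tensor H H};
  counit : {scalar H};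
  antipode : {linear H -> H};
  (* Both sides are compared in (H ⊗ H) ⊗ H. *)
  comulA : forall a : H,
    \sw_(a1, a2 <- comul a) (\sw_(a11, a12 <- comul a1) (a11 ⊗ a12 ⊗ a2)) =
    \sw_(a1, a2 <- comul a) (\sw_(a21, a22 <- comul a2) (a1 ⊗ a21 ⊗ a22));
  counitl : forall a : H, \sw_(a1, a2 <- comul a) (counit a1 *: a2) = a;
  counitr : forall a : H, \sw_(a1, a2 <- comul a) (counit a2 *: a1) = a;
  comul1 : comul 1 = 1 ⊗ 1;
  comulM : forall a b : H, comul (a * b) =
    \sw_(a1, a2 <- comul a) (\sw_(b1, b2 <- comul b) ((a1 * b1) ⊗ (a2 * b2)));
  counit1 : counit 1 = 1;
  counitM : forall a b : H, counit (a * b) = counit a * counit b;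
  antipodel : forall a : H,
    \sw_(a1, a2 <- comul a) (antipode a1 * a2) = (counit a)%:A;
  antipoder : forall a : H,
    \sw_(a1, a2 <- comul a) (a1 * antipode a2) = (counit a)%:A
}.

#[short(type="hopfAlgType")]
HB.structure Definition Hopf (K : fieldType) :=
  {H of isHopf K H & GRing.Algebra K H}.

Record universal_rform (K : fieldType) (H : hopfAlgType K)
    (r : {scalar tensor H H}) : Prop := UniversalRForm {
  rform_comm : forall a b : H,
    \sw_(a1, a2 <- comul a) (\sw_(b1, b2 <- comul b)
      (r (a1 ⊗ b1) *: (a2 * b2))) =
    \sw_(a1, a2 <- comul a) (\sw_(b1, b2 <- comul b)
      (r (a2 ⊗ b2) *: (b1 * a1)));
  rform_mull : forall a b c : H,
    r ((a * b) ⊗ c) = \sw_(c1, c2 <- comul c) (r (a ⊗ c1) * r (b ⊗ c2));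
  rform_1l : forall c : H, r (1 ⊗ c) = counit c;
  rform_mulr : forall a b c : H,
    r (a ⊗ (b * c)) = \sw_(a1, a2 <- comul a) (r (a1 ⊗ c) * r (a2 ⊗ b));
  rform_1r : forall a : H, r (a ⊗ 1) = counit a
}.

Section LeftCoideal.
Variables (K : fieldType) (H : hopfAlgType K) (P : pred H).
Variable X : subAlgType P.

Definition left_coideal : Prop :=
  forall a : X, exists t : tensor H X,
    comul (val a) = \sw_(h, x <- t) (h ⊗ val x).

(* The corestriction X -> H ⊗ X of the comultiplication; the chosen t is
   unique, since H ⊗ X embeds into H ⊗ H. *)
Definition lcoact (hX : left_coideal) (a : X) : tensor H X :=
  projT1 (cid (hX a)).

Lemma lcoactP (hX : left_coideal) (a : X) :
  comul (val a) = \sw_(h, x <- lcoact hX a) (h ⊗ val x).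
Proof. exact: projT2 (cid (hX a)). Qed.

Definition matrix_inverse_closed : Prop :=
  forall (I : finType) (x : I -> I -> X) (y : I -> I -> H),
    (forall i j, \sum_k val (x i k) * y k j = (i == j)%:R) ->
    (forall i j, \sum_k y i k * val (x k j) = (i == j)%:R) ->
    forall i j, y i j \in P.

End LeftCoideal.

Record bimodule (K : fieldType) (A : algType K) := Bimodule {
  bimod_sort :> lmodType K;
  lact : {bilinear A -> bimod_sort -> bimod_sort};
  ract : {bilinear bimod_sort -> A -> bimod_sort};
  lact1 : forall g, lact 1 g = g;
  lactM : forall a b g, lact (a * b) g = lact a (lact b g);
  ract1 : forall g, ract g 1 = g;
  ractM : forall a b g, ract g (a * b) = ract (ract g a) b;
  lractA : forall a b g, ract (lact a g) b = lact a (ract g b)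
}.
Arguments lact {K A G} : rename.
Arguments ract {K A G} : rename.

Record fodc (K : fieldType) (A : algType K) := FODC {
  fodc_bimod :> bimodule A;
  diff : {linear A -> fodc_bimod};
  diffM : forall a b : A, diff (a * b) = ract (diff a) b + lact a (diff b);
  fodc_span : forall g : fodc_bimod,
    exists s : seq (A * A), g = \sum_(p <- s) lact p.1 (diff p.2)
}.
Arguments diff {K A} G : rename.

Definition fodc_iso (K : fieldType) (A : algType K) (G G' : fodc A) : Prop :=
  exists f : {linear G -> G'},
    [/\ bijective f,
        forall a g, f (lact a g) = lact a (f g),
        forall g a, f (ract g a) = ract (f g) a
      & forall a, f (diff G a) = diff G' a].

Definition covariant (K : fieldType) (H : hopfAlgType K) (P : pred H)
    (X : subAlgType P) (hX : left_coideal X) (G : fodc X) : Prop :=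
  exists D : {linear G -> tensor H G}, forall a b : X,
    D (lact a (diff G b)) =
    \sw_(a1, a2 <- lcoact hX a) (\sw_(b1, b2 <- lcoact hX b)
      ((a1 * b1) ⊗ (lact a2 (diff G b2)))).

Section Calculus.
Variables (K : fieldType) (H : hopfAlgType K) (P : pred H).
Variables (X : subAlgType P) (hX : left_coideal X).
Variables (r : {scalar tensor H H}) (M : nat) (e b : 'I_M -> X).
Variables (pi : 'I_M -> 'I_M -> H) (nu : X -> X).

Definition chi (i : 'I_M) (a : X) : K :=
  r (val (b i) ⊗ val (nu a)) - counit (val (b i)) * counit (val a).

Definition chi_mx : 'M[K]_M := \matrix_(i, j) chi i (e j).

Definition partial (i : 'I_M) (a : X) : H :=
  \sum_j \sum_k \sw_(a1, a2 <- lcoact hX a)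
    ((chi k a2 * invmx chi_mx j k) *: (a1 * antipode (pi j i))).

Definition omega_coef (i : 'I_M) : H :=
  \sum_j \sum_k
    (counit (val (b k)) * invmx chi_mx j k) *: antipode (pi j i).

Definition unique_coefs (G : fodc X) : Prop :=
  forall a : X, exists! c : {ffun 'I_M -> X},
    diff G a = \sum_i lact (c i) (diff G (e i)).

Definition partial_coefs (G : fodc X) : Prop :=
  forall a : X, exists c : 'I_M -> X,
    (forall i, val (c i) = partial i a) /\
    diff G a = \sum_i lact (c i) (diff G (e i)).

Definition inner_by_omega (G : fodc X) : Prop :=
  exists w : 'I_M -> X,
    (forall i, val (w i) = omega_coef i) /\
    let omega := \sum_i lact (w i) (diff G (e i)) in
    forall a : X, diff G a = ract omega a - lact a omega.

End Calculus.

(* Main.v *)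
(* Write d_k(a) = a_(1) chi^k(a_(2)) and F(a)_jk = a_(1) r(psi^k_j ⊗ nu(a_(2))).
   The axioms of r make F multiplicative, and d(a) = eps(b) F(a) - a eps(b), so
   that a |-> d(a) is an inner derivation into H^M, with the right action of X
   on H^M given by F. By invertibility of chi, the rows d(e^j) form an
   invertible matrix D over H, with inverse C = (chi^-1)^T S(pi); in the basis
   d(e^j) the differential of a has coordinates d(a) C and the right action is
   D F(a) C. It remains to see that these coordinates lie in X. The commutation
   relation of r shows that d(a) psi^T, in particular D psi^T, has entries in X.
   Moreover psi^T is invertible over H, by a twisted form of the argument that
   S^2 is inner, so the inverse B of D psi^T has entries in X by the hypothesis
   on X, and d(a) C = (d(a) psi^T) B. *)
Require Import Defs.
From HB Require Import structures.
From mathcomp Require Import all_boot all_order all_algebra.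
From mathcomp Require Import sesquilinear complex boolp reals classical_sets.

Set Implicit Arguments.
Unset Strict Implicit.
Unset Printing Implicit Defensive.

Import GRing.Theory.
Local Open Scope ring_scope.

(** * Linear algebra *)

(* S is a maximal subspace meeting the image of i trivially, hence a complement. *)
Lemma linear_retraction (K : fieldType) (V W : lmodType K)
    (i : {linear V -> W}) :
  injective i -> exists p : {linear W -> V}, cancel i p.
Proof.
move=> i_inj.
pose good (S : set W) := [/\ S 0, forall k u v, S u -> S v -> S (k *: u + v)
  & forall x, S (i x) -> x = 0].
have [|S [Sgood Smax]] := @Zorn_bigcup W [set S | good S \/ S = set0]%classic.
  move=> F Fgood Ftot.
  have [[A FA A0]|F0] := pselect (exists2 A, F A & A !=set0)%classic; last first.
    right; apply/seteqP; split=> // u [A FA Au]; apply: F0.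
    by exists A => //; exists u.
  left; have gA B u : F B -> B u -> good B.
    by move=> FB Bu; case: (Fgood B FB) => // B0; rewrite B0 in Bu.
  split.
  - exists A => //; case: A0 => u Au; by have [] := gA A u FA Au.
  - move=> k u v [B FB Bu] [C FC Cv].
    case: (Ftot B C FB FC) => [BC|CB].
      by exists C => //; have [_ + _] := gA C v FC Cv; apply=> //; apply: BC.
    by exists B => //; have [_ + _] := gA B u FB Bu; apply=> //; apply: CB.
  - by move=> x [B FB Bx]; have [_ _] := gA B _ FB Bx; apply.
have {Sgood} [S0 SL Si] : good S.
  case: Sgood => // SE; case: (Smax [set 0]%classic).
    by rewrite SE; split=> [u []|/(_ 0 erefl) []].
  left; split=> // [k u v -> ->|x /=]; first by rewrite scaler0 addr0.
  by rewrite -(linear0 i) => /i_inj.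
have SZ k u : S u -> S (k *: u).
  by move=> Su; rewrite -[_ *: _]addr0; apply: SL.
have dec w : exists x, S (w - i x).
  apply: contrapT => w_notin.
  have kE k u x : S u -> k *: w + u = i x -> k = 0.
    move=> Su E; apply/eqP/negPn/negP => k0; apply: w_notin; exists (k^-1 *: x).
    rewrite linearZ_LR -E scalerDr scalerA mulVf // scale1r opprD addNKr -scalerN.
    by apply: (SZ); rewrite -scaleN1r; apply: SZ.
  (* If w had no component along the image of i, then S + Kw would be strictly larger than S, and by
     [kE] it would still meet that image trivially. *)
  apply: (Smax [set k *: w + u | k in setT & u in S]%classic).
    split; first by move=> u Su; exists 0 => //; exists u => //; rewrite scale0r add0r.
    move=> /(_ w) Sw; apply: w_notin; exists 0; rewrite linear0 subr0; apply: Sw.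
    by exists 1 => //; exists 0 => //; rewrite scale1r addr0.
  left; split.
  - by exists 0 => //; exists 0 => //; rewrite scale0r add0r.
  - move=> k _ _ [l _ [u Su <-]] [m _ [v Sv <-]].
    exists (k * l + m) => //; exists (k *: u + v); first exact: SL.
    by rewrite scalerDl -scalerA scalerDr addrACA.
  - move=> x [k _ [u Su E]]; apply: Si; rewrite -E (kE _ _ _ Su E).
    by rewrite scale0r add0r.
pose p w := projT1 (cid (dec w)).
have pP w : S (w - i (p w)) by rewrite /p; case: cid.
have p_uniq w x : S (w - i x) -> p w = x.
  move=> Sx; apply/eqP; rewrite -subr_eq0; apply/eqP/Si; rewrite linearB.
  have -> : i (p w) - i x = (-1) *: (w - i (p w)) + (w - i x).
    by rewrite scaleN1r opprB addrA subrK.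
  exact: SL.
have p_lin : linear p.
  move=> k u v; apply: p_uniq.
  have -> : k *: u + v - i (k *: p u + p v) = k *: (u - i (p u)) + (v - i (p v)).
    by rewrite linearP scalerBr opprD addrACA.
  exact: SL.
pose pL := GRing.isLinear.Build K W V *:%R p p_lin.
by exists (HB.pack_for {linear W -> V} p pL) => x; apply: p_uniq; rewrite subrr.
Qed.

Lemma linear_eq0_unitmx (K : fieldType) (V : lmodType K) n (A : 'M[K]_n)
    (t : 'I_n -> V) :
  A \in unitmx -> (forall i, \sum_j A i j *: t j = 0) -> forall j, t j = 0.
Proof.
move=> A_unit At j.
have <- : \sum_k (invmx A *m A) j k *: t k = t j.
  rewrite mulVmx // (bigD1 j) //= mxE eqxx scale1r big1 ?addr0 // => k kj.
  by rewrite mxE eq_sym (negbTE kj) scale0r.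
under eq_bigr do rewrite mxE scaler_suml.
rewrite exchange_big big1 // => i _.
by under eq_bigr do rewrite -scalerA; rewrite -scaler_sumr At scaler0.
Qed.

Lemma sum_deltal (A : pzSemiRingType) (I : finType) (F : I -> A) i :
  \sum_k (i == k)%:R * F k = F i.
Proof.
rewrite (bigD1 i) //= eqxx mul1r big1 ?addr0 // => k.
by rewrite eq_sym => /negbTE ->; rewrite mul0r.
Qed.

Lemma sum_deltar (A : pzSemiRingType) (I : finType) (F : I -> A) i :
  \sum_k F k * (k == i)%:R = F i.
Proof.
rewrite (bigD1 i) //= eqxx mulr1 big1 ?addr0 // => k /negbTE ->.
by rewrite mulr0.
Qed.

Lemma sum_scale_delta (K : fieldType) (V : lmodType K) (I : finType) (F : I -> V) i :
  \sum_k (k == i)%:R *: F k = F i.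
Proof.
rewrite (bigD1 i) //= eqxx scale1r big1 ?addr0 // => k /negbTE ->.
by rewrite scale0r.
Qed.

(** This is f = f(gh) = (fg)h = h. The index type is arbitrary, so that pairs can serve as indices,
    and the entries may lie in K, H or H ⊗ H. *)
Lemma left_inverse_eq_right_inverse (I : finType) (A : pzSemiRingType)
    (f g h : I -> I -> A) :
    (forall i j, \sum_k f i k * g k j = (i == j)%:R) ->
    (forall i j, \sum_k g i k * h k j = (i == j)%:R) ->
  forall i j, f i j = h i j.
Proof.
move=> fg gh i j.
rewrite -[LHS](sum_deltar (f i) j); under eq_bigr do rewrite -gh mulr_sumr.
rewrite exchange_big /=.
under eq_bigr do (under eq_bigr do rewrite mulrA; rewrite -mulr_suml fg).
exact: (sum_deltal (h^~ j)).
Qed.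

(** * Tensor products *)

Section TensorTheory.
Variable K : fieldType.
Implicit Types V W U : lmodType K.

HB.instance Definition _ V W := bilinear_isBilinear.Build K V W (tensor V W)
  *:%R *:%R (@tensor_pure K V W) (tensor_pure_bilinear V W).

Lemma tensorPl V W k (v v' : V) (w : W) :
  (k *: v + v') ⊗ w = k *: (v ⊗ w) + v' ⊗ w.
Proof. exact: linearPl. Qed.

Lemma tensorPr V W k (v : V) (w w' : W) :
  v ⊗ (k *: w + w') = k *: (v ⊗ w) + v ⊗ w'.
Proof. exact: linearPr. Qed.

(** Sweedler notation evaluates a chosen representative; bilinearity allows any other decomposition
    to be used in its place. *)
Lemma tensor_lift_sum V W U (f : V -> W -> U) (I : Type) (s : seq I)
    (Q : pred I) (v : I -> V) (w : I -> W) :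
  bilinear_for *:%R *:%R f ->
  tensor_lift f (\sum_(i <- s | Q i) v i ⊗ w i) =
  \sum_(i <- s | Q i) f (v i) (w i).
Proof.
move=> f_bil.
pose fL := GRing.isLinear.Build K _ _ *:%R _ (tensor_lift_is_linear f_bil).
pose F : {linear tensor V W -> U} := HB.pack (tensor_lift f) fL.
rewrite -[tensor_lift f]/(F : _ -> _) linear_sum; apply: eq_bigr => i _.
exact: tensor_lift_pure.
Qed.

Lemma tensor_ind V W (Q : tensor V W -> Prop) :
  Q 0 -> (forall s t, Q s -> Q t -> Q (s + t)) -> (forall v w, Q (v ⊗ w)) ->
  forall t, Q t.
Proof.
by move=> Q0 QD Qpure t; rewrite (tensor_sumE t) /tensor_lift; apply: big_ind.
Qed.

End TensorTheory.

Section TensorAlgebra.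
Variables (K : fieldType) (A B : algType K).

Definition tensor_one : tensor A B := 1 ⊗ 1.
(** The body has the shape of the right-hand side of [comulM], so that comultiplication becomes
    multiplicative for the ring structure on H ⊗ H. *)
Definition tensor_mul (s t : tensor A B) : tensor A B :=
  \sw_(a, b <- s) \sw_(c, d <- t) ((a * c) ⊗ (b * d)).

Let mul_bilinear_r a b :
  bilinear_for *:%R *:%R (fun (c : A) (d : B) => (a * c) ⊗ (b * d)).
Proof.
split=> [d|c] k x y /=; first by rewrite mulrDr -scalerAr linearPl.
by rewrite mulrDr -scalerAr linearPr.
Qed.

Let mul_bilinear_l (t : tensor A B) : bilinear_for *:%R *:%R
  (fun a b => \sw_(c, d <- t) ((a * c) ⊗ (b * d))).
Proof.
split=> [b|a] k x y /=; rewrite /tensor_lift scaler_sumr -big_split /=;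
  apply: eq_bigr => p _; first by rewrite mulrDl -scalerAl linearPl.
by rewrite mulrDl -scalerAl linearPr.
Qed.

Lemma tensor_mul_pure a b c d :
  tensor_mul (a ⊗ b) (c ⊗ d) = (a * c) ⊗ (b * d).
Proof. by rewrite /tensor_mul !tensor_lift_pure. Qed.

Let tensor_mulPl t : linear (tensor_mul^~ t).
Proof. exact: tensor_lift_is_linear (mul_bilinear_l t). Qed.

Let tensor_mulPr s : linear (tensor_mul s).
Proof.
move=> k x y; rewrite /tensor_mul /tensor_lift scaler_sumr -big_split /=.
apply: eq_bigr => p _.
exact: (tensor_lift_is_linear (mul_bilinear_r p.1 p.2) k x y).
Qed.

Let tensor_mulDl : left_distributive tensor_mul +%R.
Proof. by move=> x y t; rewrite -[x]scale1r tensor_mulPl !scale1r. Qed.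

Let tensor_mulDr : right_distributive tensor_mul +%R.
Proof. by move=> t x y; rewrite -[x]scale1r tensor_mulPr !scale1r. Qed.

Let tensor_mul0l : left_zero 0 tensor_mul.
Proof.
move=> t; rewrite -[in LHS](subrr 0) -scaleN1r addrC tensor_mulPl.
by rewrite scaleN1r addNr.
Qed.

Let tensor_mul0r : right_zero 0 tensor_mul.
Proof.
move=> t; rewrite -[in LHS](subrr 0) -scaleN1r addrC tensor_mulPr.
by rewrite scaleN1r addNr.
Qed.

Let tensor_mulA : associative tensor_mul.
Proof.
move=> x y z; elim/tensor_ind: x => [|? ? E E'|a a'].
- by rewrite !tensor_mul0l.
- by rewrite !tensor_mulDl E E'.
elim/tensor_ind: y => [|? ? E E'|b b'].
- by rewrite !(tensor_mul0l, tensor_mul0r).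
- by rewrite tensor_mulDr !tensor_mulDl tensor_mulDr E E'.
elim/tensor_ind: z => [|? ? E E'|c c'].
- by rewrite !tensor_mul0r.
- by rewrite !tensor_mulDr E E'.
by rewrite !tensor_mul_pure !mulrA.
Qed.

Let tensor_mul1l : left_id tensor_one tensor_mul.
Proof.
elim/tensor_ind=> [|? ? E E'|a b]; first by rewrite tensor_mul0r.
  by rewrite tensor_mulDr E E'.
by rewrite tensor_mul_pure !mul1r.
Qed.

Let tensor_mul1r : right_id tensor_one tensor_mul.
Proof.
elim/tensor_ind=> [|? ? E E'|a b]; first by rewrite tensor_mul0l.
  by rewrite tensor_mulDl E E'.
by rewrite tensor_mul_pure !mulr1.
Qed.

HB.instance Definition _ := GRing.Zmodule_isPzRing.Build (tensor A B)
  tensor_mulA tensor_mul1l tensor_mul1r tensor_mulDl tensor_mulDr.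

Lemma tensor_scalerAl k (s t : tensor A B) : k *: (s * t) = (k *: s) * t.
Proof.
by rewrite -[k *: s]addr0 [RHS]tensor_mulPl [X in _ + X]tensor_mul0l addr0.
Qed.

Lemma tensorM (a c : A) (b d : B) : (a ⊗ b) * (c ⊗ d) = (a * c) ⊗ (b * d).
Proof. exact: tensor_mul_pure. Qed.

End TensorAlgebra.

(** * Matrix corepresentations *)

Section HopfTheory.
Variables (K : fieldType) (H : hopfAlgType K).
Implicit Types a b : H.

Lemma comul_multiplicative a b : comul (a * b) = comul a * comul b.
Proof. exact: comulM. Qed.

Definition conv (f : H -> K) (a : H) : H := \sw_(a1, a2 <- comul a) (f a2 *: a1).

Lemma conv_bilinear (f : H -> K) : scalar f ->
  bilinear_for *:%R *:%R (fun a1 a2 => f a2 *: a1).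
Proof.
move=> f_lin; split=> [a2|a1] k x y /=; first by rewrite scalerDr !scalerA mulrC.
by rewrite f_lin scalerDl scalerA.
Qed.

Lemma conv_sum (f : H -> K) (I : Type) (s : seq I) (x y : I -> H) a :
  scalar f -> comul a = \sum_(i <- s) x i ⊗ y i ->
  conv f a = \sum_(i <- s) f (y i) *: x i.
Proof.
by move=> f_lin aE; rewrite /conv aE tensor_lift_sum //; apply: conv_bilinear.
Qed.

Lemma conv_linear (f : H -> K) : scalar f -> linear (conv f).
Proof.
move=> f_lin k a b; rewrite /conv linearP.
exact/tensor_lift_is_linear/conv_bilinear.
Qed.

Lemma comul_conv (f : H -> K) a : scalar f ->
  comul (conv f a) = \sw_(a1, a2 <- comul a) (a1 ⊗ conv f a2).
Proof.
move=> f_lin; pose g (t : tensor H H) (c : H) := f c *: t.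
have g_bil : bilinear_for *:%R *:%R g.
  split=> [c|t] k x y; rewrite /g /=; first by rewrite scalerDr !scalerA mulrC.
  by rewrite f_lin scalerDl scalerA.
(* [G] applies f to the third leg; the claim is [comulA] seen through [G]. *)
have [G Gpure] : exists G : {linear tensor (tensor H H) H -> tensor H H},
    forall t c, G (t ⊗ c) = f c *: t.
  pose gL := GRing.isLinear.Build K _ _ *:%R _ (tensor_lift_is_linear g_bil).
  pose G : {linear tensor (tensor H H) H -> tensor H H} :=
    HB.pack (tensor_lift g) gL.
  by exists G => t c; apply: tensor_lift_pure.
transitivity (\sum_(p <- repr (comul a)) f p.2 *: comul p.1).
  by rewrite /conv /tensor_lift linear_sum; apply: eq_bigr => p _; rewrite linearZ_LR.
transitivity (\sum_(p <- repr (comul a)) \sw_(a11, a12 <- comul p.1) G (a11 ⊗ a12 ⊗ p.2)).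
  apply: eq_bigr => p _; rewrite [in LHS](tensor_sumE (comul p.1)).
  by rewrite /tensor_lift scaler_sumr; apply: eq_bigr => q _; rewrite Gpure.
transitivity (\sum_(p <- repr (comul a)) \sw_(a21, a22 <- comul p.2) G (p.1 ⊗ a21 ⊗ a22)).
  have := congr1 G (comulA a); rewrite /tensor_lift !linear_sum.
  under eq_bigr do rewrite linear_sum.
  under [RHS]eq_bigr do rewrite linear_sum.
  by [].
apply: eq_bigr => p _; rewrite /conv /tensor_lift linear_sumr.
by apply: eq_bigr => q _; rewrite Gpure linearZr_LR.
Qed.

End HopfTheory.

Section Corepresentation.
Variables (K : fieldType) (H : hopfAlgType K).

Definition corep n (u : 'M[H]_n) : Prop :=
  (forall i j, comul (u i j) = \sum_k u i k ⊗ u k j) /\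
  (forall i j, counit (u i j) = (i == j)%:R).

(* The hypothesis on f forces the b j to be linearly independent; without that, u
   would not be determined by the coaction. *)
Lemma corep_of_coaction n (u : 'M[H]_n) (b : 'I_n -> H) (f : 'I_n -> H -> K) :
    (forall i, comul (b i) = \sum_j u i j ⊗ b j) -> (forall i, scalar (f i)) ->
    \matrix_(i, j) f i (b j) \in unitmx ->
  corep u.
Proof.
move=> b_comul f_lin f_unit.
have convb k i : conv (f k) (b i) = \sum_j f k (b j) *: u i j.
  exact: conv_sum.
split=> i j; apply/eqP; rewrite -subr_eq0; apply/eqP; move: j.
  apply: (linear_eq0_unitmx f_unit) => k.
  under eq_bigr do rewrite mxE scalerBr.
  rewrite sumrB; apply/eqP; rewrite subr_eq0; apply/eqP.
  (* Linearity turns this into the combination of the comul (u i j) with coefficients f k (b j), and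
     [comul_conv] into the same combination of the sums over l of u i l ⊗ u l j. Invertibility of
     the coefficient matrix then allows termwise comparison. *)
  transitivity (comul (conv (f k) (b i))).
    by rewrite convb linear_sum; apply: eq_bigr => j _; rewrite linearZ_LR.
  rewrite comul_conv // b_comul tensor_lift_sum; last first.
    split=> [a2|a1] l x y /=; first by rewrite linearPl.
    by rewrite conv_linear //; exact: tensorPr.
  under eq_bigr do rewrite convb linear_sumr.
  rewrite exchange_big; apply: eq_bigr => j _ /=.
  by rewrite scaler_sumr; apply: eq_bigr => l _; rewrite linearZr_LR.
have bE : \sum_j counit (u i j) *: b j = b i.
  rewrite -[RHS]counitl b_comul tensor_lift_sum //.
  split=> [a2|a1] l x y /=; last by rewrite scalerDr !scalerA mulrC.
  by rewrite linearP scalerDl scalerA.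
pose fL k := GRing.isLinear.Build K H K *%R (f k) (f_lin k).
pose F k : {scalar H} := HB.pack (f k) (fL k).
apply: (linear_eq0_unitmx (V := K^o) f_unit) => k.
transitivity (F k (\sum_j (counit (u i j) - (i == j)%:R) *: b j)).
  by rewrite linear_sum; apply: eq_bigr => j _; rewrite linearZ mxE /= mulrC.
under eq_bigr do rewrite scalerBl eq_sym.
by rewrite sumrB bE sum_scale_delta subrr linear0.
Qed.

Lemma corep_mulVmx n (u : 'M[H]_n) : corep u ->
  map_mx antipode u *m u = 1%:M.
Proof.
move=> [uD ue]; apply/matrixP => i j; rewrite !mxE.
under eq_bigr do rewrite mxE.
have := antipodel (u i j); rewrite uD ue tensor_lift_sum => [->|].
  by rewrite scaler_nat.
split=> [a2|a1] k x y /=; first by rewrite linearP mulrDl scalerAl.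
by rewrite mulrDr scalerAr.
Qed.

Lemma corep_mulmxV n (u : 'M[H]_n) : corep u ->
  u *m map_mx antipode u = 1%:M.
Proof.
move=> [uD ue]; apply/matrixP => i j; rewrite !mxE.
under eq_bigr do rewrite mxE.
have := antipoder (u i j); rewrite uD ue tensor_lift_sum => [->|].
  by rewrite scaler_nat.
split=> [a2|a1] k x y /=; first by rewrite mulrDl scalerAl.
by rewrite linearP mulrDr scalerAr.
Qed.

Lemma corep_mulVE n (u : 'M[H]_n) i j : corep u ->
  \sum_k antipode (u i k) * u k j = (i == j)%:R.
Proof.
move=> /corep_mulVmx/matrixP/(_ i j); rewrite !mxE => <-.
by apply: eq_bigr => k _; rewrite mxE.
Qed.

Lemma corep_mulEV n (u : 'M[H]_n) i j : corep u ->
  \sum_k u i k * antipode (u k j) = (i == j)%:R.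
Proof.
move=> /corep_mulmxV/matrixP/(_ i j); rewrite !mxE => <-.
by apply: eq_bigr => k _; rewrite mxE.
Qed.

(** Over H ⊗ H, the matrix comul(u) has the right inverse comul(S(u)), by applying comul to u S(u) =
    1, and the expected coproduct of S(u) is a left inverse by direct computation; hence the two
    agree. This yields the anticomultiplicativity of S on matrix entries. *)
Lemma corep_dual n (u : 'M[H]_n) : corep u -> corep (map_mx antipode u)^T.
Proof.
move=> u_corep; have [uD ue] := u_corep.
split=> i j.
  rewrite !mxE; under eq_bigr do rewrite !mxE.
  apply/esym; move: j i.
  apply: (@left_inverse_eq_right_inverse _ _ _ (fun i j => comul (u i j))) => i j; last first.
    under eq_bigr do rewrite -comul_multiplicative.
    by rewrite -linear_sum corep_mulEV // raddfMn /= comul1.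
  under eq_bigr do rewrite uD mulr_suml.
  rewrite exchange_big /=.
  transitivity (\sum_(l < n) (1 : H) ⊗ (antipode (u i l) * u l j)); last first.
    by rewrite -linear_sumr corep_mulVE // linearMnr.
  apply: eq_bigr => l _.
  under eq_bigr do (rewrite mulr_sumr; under eq_bigr do rewrite tensorM).
  rewrite exchange_big /=.
  under eq_bigr do rewrite -linear_sumlz corep_mulVE //.
  rewrite (bigD1 l) //= eqxx big1 ?addr0 // => m.
  by rewrite eq_sym => /negbTE ->; rewrite linear0l.
rewrite !mxE.
have := congr1 counit (corep_mulVE j i u_corep); rewrite linear_sum /=.
under eq_bigr do rewrite counitM ue.
by rewrite sum_deltar raddfMn /= counit1 eq_sym.
Qed.

Lemma comul_antipode n (u : 'M[H]_n) i j : corep u ->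
  comul (antipode (u i j)) = \sum_k antipode (u k j) ⊗ antipode (u i k).
Proof.
move=> /corep_dual[/(_ j i)]; rewrite !mxE => -> _.
by apply: eq_bigr => k _; rewrite !mxE.
Qed.

Lemma counit_antipode n (u : 'M[H]_n) i j : corep u ->
  counit (antipode (u i j)) = (i == j)%:R.
Proof. by move=> /corep_dual[_ /(_ j i)]; rewrite !mxE eq_sym. Qed.

End Corepresentation.

(** * The universal r-form *)

Section RForm.
Variables (K : fieldType) (H : hopfAlgType K) (r : {scalar tensor H H}).
Hypothesis r_univ : universal_rform r.

Lemma rform_mulr_sum (I : Type) (s : seq I) (x y : I -> H) a b c :
  comul a = \sum_(i <- s) x i ⊗ y i ->
  r (a ⊗ (b * c)) = \sum_(i <- s) r (x i ⊗ c) * r (y i ⊗ b).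
Proof.
move=> aE; rewrite (rform_mulr r_univ) aE (@tensor_lift_sum _ _ _ K^o) //.
split=> [a2|a1] k z w /=; rewrite tensorPl linearP /= ?mulrDl ?mulrDr.
  by rewrite -mulrA.
by rewrite mulrCA.
Qed.

Lemma rform_mull_sum (I : Type) (s : seq I) (x y : I -> H) a b c :
  comul c = \sum_(i <- s) x i ⊗ y i ->
  r ((a * b) ⊗ c) = \sum_(i <- s) r (a ⊗ x i) * r (b ⊗ y i).
Proof.
move=> cE; rewrite (rform_mull r_univ) cE (@tensor_lift_sum _ _ _ K^o) //.
split=> [a2|a1] k z w /=; rewrite tensorPr linearP /= ?mulrDl ?mulrDr.
  by rewrite -mulrA.
by rewrite mulrCA.
Qed.

Lemma rform_comm_sum (I J : Type) (s : seq I) (t : seq J) (x y : I -> H)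
    (z w : J -> H) a b :
  comul a = \sum_(i <- s) x i ⊗ y i -> comul b = \sum_(j <- t) z j ⊗ w j ->
  \sum_(i <- s) \sum_(j <- t) r (x i ⊗ z j) *: (y i * w j) =
  \sum_(i <- s) \sum_(j <- t) r (y i ⊗ w j) *: (z j * x i).
Proof.
move=> aE bE; have := rform_comm r_univ a b; rewrite aE bE.
have bil1 (c d : H) : bilinear_for *:%R *:%R (fun b1 b2 => r (c ⊗ b1) *: (d * b2)).
  split=> [b2|b1] k u v /=; first by rewrite tensorPr linearP scalerDl scalerA.
  by rewrite mulrDr scalerDr -scalerAr !scalerA mulrC.
have bil2 (c d : H) : bilinear_for *:%R *:%R (fun b1 b2 => r (d ⊗ b2) *: (b1 * c)).
  split=> [b2|b1] k u v /=; last by rewrite tensorPr linearP scalerDl scalerA.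
  by rewrite mulrDl scalerDr -scalerAl !scalerA mulrC.
rewrite !tensor_lift_sum.
- under eq_bigr do rewrite tensor_lift_sum //.
  by under [X in _ = X -> _]eq_bigr do rewrite tensor_lift_sum //.
- split=> [a2|a1] k u v /=; rewrite !tensor_lift_sum // scaler_sumr -big_split;
    apply: eq_bigr => j _ /=; first by rewrite mulrDr scalerDr -scalerAr !scalerA mulrC.
  by rewrite tensorPl linearP scalerDl scalerA.
split=> [a2|a1] k u v /=; rewrite !tensor_lift_sum // scaler_sumr -big_split;
    apply: eq_bigr => j _ /=; first by rewrite tensorPl linearP scalerDl scalerA.
by rewrite mulrDl scalerDr -scalerAl !scalerA mulrC.
Qed.

Lemma rform_deltal (b : bool) x : r (b%:R ⊗ x) = b%:R * counit x.
Proof. by case: b; rewrite ?(rform_1l r_univ) ?mul1r // linear0l linear0 mul0r. Qed.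

Lemma rform_deltar (b : bool) x : r (x ⊗ b%:R) = b%:R * counit x.
Proof. by case: b; rewrite ?(rform_1r r_univ) ?mul1r // linear0r linear0 mul0r. Qed.

(* Both r and r o (S ⊗ S) are convolution inverses of r o (S ⊗ id). *)
Lemma rform_antipode n m (u : 'M[H]_n) (v : 'M[H]_m) i j k l :
    corep u -> corep v ->
  r (antipode (u i j) ⊗ antipode (v k l)) = r (u i j ⊗ v k l).
Proof.
move=> u_corep v_corep; apply/esym.
(* With pairs as indices, convolution of functionals on H ⊗ H becomes matrix multiplication. *)
apply: (@left_inverse_eq_right_inverse _ _
    (fun p q : 'I_n * 'I_m => r (u p.1 q.1 ⊗ v p.2 q.2))
    (fun p q => r (antipode (u p.1 q.1) ⊗ v p.2 q.2))
    (fun p q => r (antipode (u p.1 q.1) ⊗ antipode (v p.2 q.2))) _ _ (i, k) (j, l));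
  move=> {i j k l} [i k] [j l] /=; rewrite xpair_eqE.
- rewrite -(pair_bigA _ (fun p q => r (u i p ⊗ v k q) * r (antipode (u p j) ⊗ v q l))) /=.
  under eq_bigr do rewrite -(rform_mull_sum _ _ (v_corep.1 _ _)).
  rewrite -linear_sum -linear_sumlz corep_mulEV // rform_deltal v_corep.2.
  by case: (i == j); case: (k == l); rewrite ?mul1r ?mul0r.
- rewrite -(pair_bigA _ (fun p q => r (antipode (u i p) ⊗ v k q) *
    r (antipode (u p j) ⊗ antipode (v q l)))) exchange_big /=.
  under eq_bigr do (under eq_bigr do rewrite mulrC;
    rewrite -(rform_mulr_sum _ _ (comul_antipode _ _ u_corep))).
  rewrite -linear_sum -linear_sumr corep_mulEV // rform_deltar counit_antipode //.
  by case: (i == j); case: (k == l); rewrite ?mul1r ?mul0r.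
Qed.

(* V and W are the values on u of the functional a |-> r(a_(2) ⊗ S(a_(1))), which
   intertwines the identity with S^2, and of its convolution inverse
   a |-> r(S^2(a_(2)) ⊗ a_(1)). *)
Lemma trmx_corep_inv n (u : 'M[H]_n) : corep u ->
  exists y : 'M[H]_n, u^T *m y = 1%:M /\ y *m u^T = 1%:M.
Proof.
move=> u_corep; have Su_corep := corep_dual u_corep.
pose V : 'M[K]_n := \matrix_(m, l) \sum_i r (u i l ⊗ antipode (u m i)).
pose W : 'M[K]_n := \matrix_(l, j) \sum_i r (antipode (antipode (u i j)) ⊗ u l i).
pose V' := map_mx (in_alg H) V^T; pose W' := map_mx (in_alg H) W^T.
pose Su := (map_mx antipode u)^T; pose S2u := map_mx antipode Su.
have SuS2u : Su *m S2u = 1%:M by exact: corep_mulmxV.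
(* This is [rform_comm] for u i j and S(u k i), summed over i: on its right-hand side the products
   S(u m i) u i l collapse to deltas. *)
have rel1 : u^T *m V' *m Su = V'.
  apply/matrixP => j k; rewrite !mxE.
  transitivity (\sum_i \sum_l \sum_m r (u i l ⊗ antipode (u m i)) *:
      (u l j * antipode (u k m))).
    rewrite exchange_big /=.
    under [RHS]eq_bigr do rewrite exchange_big.
    rewrite exchange_big; apply: eq_bigr => m _ /=; rewrite !mxE.
    rewrite mulr_suml; apply: eq_bigr => l _; rewrite !mxE.
    by rewrite mulr_algr -scalerAl -scaler_suml.
  under eq_bigr do
    rewrite (rform_comm_sum (u_corep.1 _ _) (comul_antipode _ _ u_corep)).
  rewrite exchange_big /=; under eq_bigr do rewrite exchange_big.
  rewrite /= scaler_suml.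
  apply: eq_bigr => l _; rewrite (bigD1 l) //= -scaler_sumr corep_mulVE // eqxx.
  rewrite big1 ?addr0 // => m ml.
  by rewrite -scaler_sumr corep_mulVE // (negbTE ml) scaler0.
have rel2 : u^T *m V' = V' *m S2u.
  by rewrite -[in RHS]rel1 -[RHS]mulmxA SuS2u mulmx1.
(* By [rel2], S^2 appears in both arguments of r and is removed by using [rform_antipode] twice;
   [rform_mulr] then merges the two values of r into one at u S(u) = 1. *)
have VW : V *m W = 1%:M.
  apply/matrixP => l j; rewrite !mxE.
  transitivity (\sum_i r (antipode (antipode (u i j)) ⊗ (\sum_k V l k *: u k i))).
    under eq_bigr do rewrite [W _ _]mxE mulr_sumr.
    rewrite exchange_big; apply: eq_bigr => i _ /=.
    by rewrite linear_sumr linear_sum; apply: eq_bigr => k _; rewrite linearZr_LR linearZ.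
  have rel2E i : \sum_k V l k *: u k i = \sum_k V k i *: antipode (antipode (u l k)).
    have /matrixP/(_ i l) := rel2; rewrite !mxE => E.
    transitivity (\sum_k u^T i k * V' k l).
      by apply: eq_bigr => k _; rewrite !mxE mulr_algr.
    by rewrite E; apply: eq_bigr => k _; rewrite !mxE mulr_algl.
  under eq_bigr do rewrite rel2E linear_sumr linear_sum.
  have r2 i k : r (antipode (antipode (u i j)) ⊗ antipode (antipode (u l k))) =
      r (u i j ⊗ u l k).
    have := rform_antipode j i k l Su_corep Su_corep; rewrite !mxE => ->.
    exact: rform_antipode.
  transitivity (\sum_p \sum_k r (u p j ⊗ (u l k * antipode (u k p)))).
    under [RHS]eq_bigr do under eq_bigr do rewrite (rform_mulr_sum _ _ (u_corep.1 _ _)).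
    under [RHS]eq_bigr do rewrite exchange_big.
    rewrite [RHS]exchange_big; apply: eq_bigr => i _ /=.
    rewrite [RHS]exchange_big; apply: eq_bigr => k _ /=.
    rewrite linearZr_LR linearZ /= mxE mulr_suml; apply: eq_bigr => p _.
    by rewrite r2.
  under eq_bigr do rewrite -linear_sum -linear_sumr corep_mulEV // rform_deltar u_corep.2.
  exact: sum_deltal.
(* The square matrices V and W have entries in the field K, so their one-sided inverse is two-sided;
   transposition exchanges the two sides. *)
have VW' : V' *m W' = 1%:M.
  by rewrite -map_mxM -trmx_mul (mulmx1C VW) trmx1 map_mx1.
have WV' : W' *m V' = 1%:M by rewrite -map_mxM -trmx_mul VW trmx1 map_mx1.
exists (V' *m Su *m W'); split; first by rewrite !mulmxA rel1.
have rel3 : W' *m u^T = S2u *m W'.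
  rewrite -[W' *m _]mulmx1 -VW' mulmxA -[W' *m _ *m _]mulmxA rel2 mulmxA WV'.
  by rewrite mul1mx.
by rewrite -[LHS]mulmxA rel3 mulmxA -[V' *m Su *m S2u]mulmxA SuS2u mulmx1.
Qed.

End RForm.

(** * Left coideal subalgebras *)

Section Coideal.
Variables (K : fieldType) (H : hopfAlgType K) (P : pred H).
Variables (X : subAlgType P) (X_coideal : left_coideal X).
Variables (p : {linear H -> X}) (pK : cancel val p).

Local Notation lcoact := (lcoact X_coideal).

Lemma comul_lcoact (a : X) :
  comul (val a) = \sum_(q <- repr (lcoact a)) q.1 ⊗ val q.2.
Proof. exact: lcoactP. Qed.

Let tensor_p_bilinear :
  bilinear_for *:%R *:%R (fun (h : H) (y : H) => h ⊗ p y).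
Proof.
split=> [y|g] k z w /=; first exact: tensorPl.
by rewrite linearP; exact: tensorPr.
Qed.

(** [lcoact] is obtained by choice. Since p cancels the embedding in the second leg, the chosen
    tensor is determined by comul, hence linear and multiplicative in a. *)
Lemma lcoactE (a : X) : lcoact a = \sw_(h, y <- comul (val a)) (h ⊗ p y).
Proof.
rewrite comul_lcoact tensor_lift_sum // [LHS]tensor_sumE.
by apply: eq_bigr => q _; rewrite pK.
Qed.

Lemma lcoact_eq (I : Type) (s : seq I) (h : I -> H) (x : I -> X) a :
  comul (val a) = \sum_(i <- s) h i ⊗ val (x i) ->
  lcoact a = \sum_(i <- s) h i ⊗ x i.
Proof.
move=> aE; rewrite lcoactE aE tensor_lift_sum //.
by apply: eq_bigr => i _; rewrite pK.
Qed.

Lemma lcoact_linear : linear lcoact.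
Proof.
by move=> k a b; rewrite !lcoactE !linearP (tensor_lift_is_linear tensor_p_bilinear).
Qed.

Lemma comulM_lcoact (a b : X) : comul (val (a * b)) =
  \sum_(z <- [seq (q, s) | q <- repr (lcoact a), s <- repr (lcoact b)])
    (z.1.1 * z.2.1) ⊗ val (z.1.2 * z.2.2).
Proof.
rewrite big_allpairs rmorphM comul_multiplicative !comul_lcoact mulr_suml.
apply: eq_bigr => i _; rewrite mulr_sumr; apply: eq_bigr => j _.
by rewrite tensorM rmorphM.
Qed.

Lemma lcoactM a b : lcoact (a * b) = lcoact a * lcoact b.
Proof.
rewrite (lcoact_eq (comulM_lcoact a b)) big_allpairs.
rewrite [in RHS](tensor_sumE (lcoact a)) [in RHS](tensor_sumE (lcoact b)).
rewrite /tensor_lift mulr_suml; apply: eq_bigr => q _.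
by rewrite mulr_sumr; apply: eq_bigr => s _; rewrite tensorM.
Qed.

(* As f is only defined on X, it is extended along the retraction p; the result
   a_(1) f(a_(2)) does not depend on p. *)
Definition convX (f : X -> K) (a : X) : H := conv (f \o p) (val a).

Lemma convX_sum (f : X -> K) (I : Type) (s : seq I) (h : I -> H) (x : I -> X) a :
  scalar f -> comul (val a) = \sum_(i <- s) h i ⊗ val (x i) ->
  convX f a = \sum_(i <- s) f (x i) *: h i.
Proof.
move=> f_lin aE; rewrite /convX (conv_sum _ aE) => [|k u v /=].
  by apply: eq_bigr => i _ /=; rewrite pK.
by rewrite linearP f_lin.
Qed.

Lemma convX_linear (f : X -> K) : scalar f -> linear (convX f).
Proof.
move=> f_lin k a b; rewrite /convX linearP conv_linear // => l u v /=.
by rewrite linearP f_lin.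
Qed.

(** The last hypothesis gives f the coproduct formed by the g l ⊗ h l; multiplicativity of comul
    carries it over to convolution. For matrix coefficients f this produces a matrix product. *)
Lemma convXM (n : nat) (f : X -> K) (g h : 'I_n -> X -> K) a b :
    scalar f -> (forall l, scalar (g l)) -> (forall l, scalar (h l)) ->
    (forall x y, f (x * y) = \sum_l g l x * h l y) ->
  convX f (a * b) = \sum_l convX (g l) a * convX (h l) b.
Proof.
move=> f_lin g_lin h_lin fM.
rewrite (convX_sum f_lin (comulM_lcoact a b)) big_allpairs.
under [RHS]eq_bigr do rewrite (convX_sum _ (comul_lcoact a)) //
  (convX_sum _ (comul_lcoact b)) // mulr_suml.
rewrite [RHS]exchange_big; apply: eq_bigr => q _ /=.
under [RHS]eq_bigr do rewrite mulr_sumr.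
rewrite [RHS]exchange_big; apply: eq_bigr => s _ /=.
rewrite fM scaler_suml; apply: eq_bigr => l _.
by rewrite -scalerAl -scalerAr scalerA.
Qed.

Lemma comul_convX (f : X -> K) a : scalar f ->
  comul (convX f a) = \sum_(q <- repr (lcoact a)) q.1 ⊗ convX f q.2.
Proof.
move=> f_lin; have fp_lin : scalar (f \o p) by move=> k u v /=; rewrite linearP f_lin.
rewrite /convX comul_conv // comul_lcoact tensor_lift_sum //.
split=> [y|g] k z w /=; first exact: tensorPl.
by rewrite conv_linear //; exact: tensorPr.
Qed.

End Coideal.

(** * The calculus *)

Section Calculus.
Variables (K : fieldType) (H : hopfAlgType K) (r : {scalar tensor H H}).
Hypothesis r_univ : universal_rform r.
Variables (P : pred H) (X : subAlgType P) (X_coideal : left_coideal X).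
Hypothesis X_inv : matrix_inverse_closed X.
Variables (M : nat) (e b : 'I_M -> X) (pi psi : 'I_M -> 'I_M -> H).
Hypothesis e_comul : forall i, comul (val (e i)) = \sum_j pi i j ⊗ val (e j).
Hypothesis b_comul : forall i, comul (val (b i)) = \sum_j psi i j ⊗ val (b j).
Variable nu : {lrmorphism X -> X}.
Hypothesis nu_covariant : forall a : X, lcoact X_coideal (nu a) =
  \sw_(a1, a2 <- lcoact X_coideal a) (a1 ⊗ nu a2).
Hypothesis chi_unit : chi_mx r e b nu \in unitmx.
Variables (p : {linear H -> X}) (pK : cancel val p).

Local Notation lcoact := (lcoact X_coideal).
Local Notation chi := (chi r b nu).
Local Notation chiM := (chi_mx r e b nu).
Local Notation convX := (convX p).

Let Pi := \matrix_(i, j) pi i j.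
Let Psi := \matrix_(i, j) psi i j.

(** * The inner derivation into H^M and its change of basis *)

Lemma chi_scalar k : scalar (chi k).
Proof.
move=> l x y; rewrite /chi !linearP linearPr linearP /=.
by rewrite mulrBr mulrDr opprD mulrCA addrACA.
Qed.

Definition psi_form (k j : 'I_M) (a : X) : K := r (psi k j ⊗ val (nu a)).

Lemma psi_form_scalar k j : scalar (psi_form k j).
Proof. by move=> l x y; rewrite /psi_form !linearP linearPr linearP. Qed.

Lemma pi_corep : corep Pi.
Proof.
apply: (@corep_of_coaction _ _ _ _ (val \o e) (fun i => chi i \o p)) => /=.
- by move=> i; rewrite e_comul; apply: eq_bigr => j _; rewrite mxE.
- by move=> i k u v /=; rewrite linearP chi_scalar.
rewrite (_ : \matrix_(i, j) _ = chiM) //.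
by apply/matrixP => i j; rewrite !mxE pK.
Qed.

Lemma psi_corep : corep Psi.
Proof.
(* This is chi read as a functional of its first argument; on the b^i it yields the transpose of the
   matrix chi. *)
pose f j h := r (h ⊗ val (nu (e j))) - counit h * counit (val (e j)).
apply: (@corep_of_coaction _ _ _ _ (val \o b) f) => /=.
- by move=> i; rewrite b_comul; apply: eq_bigr => j _; rewrite mxE.
- move=> i k u v; rewrite /f linearPl !linearP /=.
  by rewrite mulrDl mulrBr opprD addrACA mulrA.
rewrite (_ : \matrix_(i, j) _ = chiM^T) ?unitmx_tr //.
by apply/matrixP => i j; rewrite !mxE.
Qed.

(* dvec, fmx, dmx and cmx are d, F, D and C of the header comment. *)
Definition dvec (a : X) : 'rV[H]_M := \row_k convX (chi k) a.
Definition fmx (a : X) : 'M[H]_M := \matrix_(j, k) convX (psi_form k j) a.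
Definition dmx : 'M[H]_M := \matrix_(j, k) \sum_i chiM k i *: pi j i.
Definition cmx : 'M[H]_M :=
  \matrix_(k, i) \sum_j invmx chiM j k *: antipode (pi j i).
Definition counit_row : 'rV[H]_M := \row_k (counit (val (b k)))%:A.

Lemma dmxE : dmx = Pi *m map_mx (in_alg H) chiM^T.
Proof.
apply/matrixP => j k; rewrite !mxE; apply: eq_bigr => i _.
by rewrite !mxE mulr_algr.
Qed.

Lemma cmxE : cmx = map_mx (in_alg H) (invmx chiM)^T *m map_mx antipode Pi.
Proof.
apply/matrixP => j k; rewrite !mxE; apply: eq_bigr => i _.
by rewrite !mxE mulr_algl.
Qed.

Lemma dmx_cmx : dmx *m cmx = 1%:M.
Proof.
rewrite dmxE cmxE mulmxA -[Pi *m _ *m _]mulmxA -map_mxM -trmx_mul mulVmx //.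
by rewrite trmx1 map_mx1 mulmx1 (corep_mulmxV pi_corep).
Qed.

Lemma cmx_dmx : cmx *m dmx = 1%:M.
Proof.
rewrite dmxE cmxE mulmxA -[_ *m Pi]mulmxA (corep_mulVmx pi_corep) mulmx1.
by rewrite -map_mxM -trmx_mul mulmxV // trmx1 map_mx1.
Qed.

Lemma cmx_dmxK n (A : 'M[H]_(n, M)) : A *m cmx *m dmx = A.
Proof. by rewrite -mulmxA cmx_dmx mulmx1. Qed.

Lemma comul_nu a :
  comul (val (nu a)) = \sum_(q <- repr (lcoact a)) q.1 ⊗ val (nu q.2).
Proof.
rewrite lcoactP nu_covariant tensor_lift_sum //.
split=> [y|g] k z w /=; first exact: tensorPl.
by rewrite linearP; exact: tensorPr.
Qed.

Lemma dvec_e j : dvec (e j) = row j dmx.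
Proof.
apply/rowP => k; rewrite !mxE (convX_sum pK (@chi_scalar k) (e_comul j)).
by apply: eq_bigr => i _; rewrite mxE.
Qed.

Lemma fmx1 : fmx 1 = 1%:M.
Proof.
apply/matrixP => j k; rewrite !mxE.
have c1 : comul (val (1 : X)) = \sum_(i < 1) 1 ⊗ val (1 : X).
  by rewrite big_ord1 rmorph1 comul1.
rewrite (convX_sum pK (@psi_form_scalar k j) c1) big_ord1 /psi_form !rmorph1.
rewrite (rform_1r r_univ); have := psi_corep.2 k j; rewrite mxE => ->.
by rewrite scaler_nat eq_sym.
Qed.

Lemma psi_comul k j : comul (psi k j) = \sum_l psi k l ⊗ psi l j.
Proof.
have := psi_corep.1 k j; rewrite mxE => ->.
by apply: eq_bigr => l _; rewrite !mxE.
Qed.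

(** [rform_mulr] reverses the order of a product in the second argument of r; the transposed indices
    in [fmx] compensate for this. *)
Lemma fmxM x y : fmx (x * y) = fmx x *m fmx y.
Proof.
apply/matrixP => j k; rewrite !mxE.
under eq_bigr do rewrite !mxE.
apply: (@convXM _ _ _ _ X_coideal p pK _ _ (psi_form^~ j) (psi_form k))
  => [|l|l|u v]; try exact: psi_form_scalar.
rewrite /psi_form !rmorphM (rform_mulr_sum r_univ _ _ (psi_comul k j)).
by apply: eq_bigr => l _; rewrite mulrC.
Qed.

Lemma comul_counit_r a : \sum_(q <- repr (lcoact a)) counit (val q.2) *: q.1 = val a.
Proof.
rewrite -[RHS]counitr (comul_lcoact X_coideal) tensor_lift_sum //.
apply: conv_bilinear; exact: scalarP.
Qed.

Lemma counit_psi i : \sum_j counit (val (b j)) *: psi i j = val (b i).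
Proof.
rewrite -[RHS]counitr b_comul tensor_lift_sum //.
apply: conv_bilinear; exact: scalarP.
Qed.

(** By the counit axiom b^k is the sum of the ε(b^j) ψ^k_j, so r(b^k ⊗ ν(-)) is a combination of the
    [psi_form]; the term ε(b^k) ε(a) of chi contributes a ε(b^k). *)
Lemma dvecE a : dvec a = counit_row *m fmx a - val a *: counit_row.
Proof.
apply/rowP => k; rewrite !mxE.
rewrite (convX_sum pK (@chi_scalar k) (comul_lcoact X_coideal a)).
under eq_bigr do rewrite scalerBl -scalerA.
rewrite sumrB -scaler_sumr comul_counit_r mulr_algr; congr (_ - _).
under [RHS]eq_bigr => j do rewrite !mxE mulr_algl
  (convX_sum pK (@psi_form_scalar k j) (comul_lcoact X_coideal a)) scaler_sumr.
rewrite exchange_big; apply: eq_bigr => q _ /=.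
under eq_bigr do rewrite scalerA; rewrite -scaler_suml; congr (_ *: _).
rewrite -[in LHS]counit_psi linear_sumlz linear_sum; apply: eq_bigr => j _.
by rewrite linearZl_LR linearZ.
Qed.

Lemma dvecM x y : dvec (x * y) = dvec x *m fmx y + val x *: dvec y.
Proof.
rewrite !dvecE fmxM rmorphM mulmxBl mulmxA scalerBr scalerA -scalemxAl.
by rewrite addrA subrK.
Qed.

Lemma dvec_linear k x y : dvec (k *: x + y) = k%:A *: dvec x + dvec y.
Proof.
by apply/rowP => j; rewrite !mxE mulr_algl convX_linear //; apply: chi_scalar.
Qed.

(** * The coefficients of da and ω, and their membership in X *)

Lemma partialE i a : partial X_coideal r e b pi nu i a = (dvec a *m cmx) 0 i.
Proof.
rewrite mxE /partial exchange_big; apply: eq_bigr => k _ /=.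
rewrite [cmx _ _]mxE mulr_sumr; apply: eq_bigr => j _.
rewrite mxE (convX_sum pK (@chi_scalar k) (comul_lcoact X_coideal a)).
rewrite -scalerAr mulr_suml scaler_sumr; apply: eq_bigr => q _.
by rewrite -scalerAl scalerA mulrC.
Qed.

Lemma omega_coefE i : omega_coef r e b pi nu i = (counit_row *m cmx) 0 i.
Proof.
rewrite mxE /omega_coef exchange_big; apply: eq_bigr => k _ /=.
rewrite [cmx _ _]mxE mulr_sumr; apply: eq_bigr => j _.
by rewrite mxE mulr_algl scalerA.
Qed.

(* The defining commutation relation of r rewrites the sum as
   r(psi^q_k ⊗ a_(1)) b^k nu(a_(2)) - a b^q. *)
Lemma dvec_psi_mem a q : (dvec a *m Psi^T) 0 q \in P.
Proof.
have := rform_comm_sum r_univ (b_comul q) (comul_nu a).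
move=> E; have valZ k (x : X) : val (k *: x) = k *: val x by rewrite linearZ.
suff -> : (dvec a *m Psi^T) 0 q = val (\sum_k \sum_(s <- repr (lcoact a))
    r (psi q k ⊗ s.1) *: (b k * nu s.2) - a * b q) by apply: valP.
rewrite rmorphB rmorphM raddf_sum /=.
under [X in _ = X - _]eq_bigr do
  (rewrite raddf_sum; under eq_bigr do rewrite /= valZ rmorphM).
rewrite E -counit_psi mulr_sumr -sumrB mxE; apply: eq_bigr => k _.
rewrite !mxE (convX_sum pK (@chi_scalar k) (comul_lcoact X_coideal a)).
rewrite -scalerAr -[in RHS](comul_counit_r a) !mulr_suml scaler_sumr.
rewrite -sumrB; apply: eq_bigr => s _.
by rewrite -!scalerAl scalerA -scalerBl.
Qed.

Lemma cmx_factor : exists2 B : 'M[H]_M,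
  (forall i j, B i j \in P) & cmx = Psi^T *m B.
Proof.
have [Y [psiY Ypsi]] := trmx_corep_inv r_univ psi_corep.
exists (Y *m cmx); last by rewrite mulmxA psiY mul1mx.
pose A := dmx *m Psi^T.
have A_mem i j : A i j \in P.
  have := dvec_psi_mem (e i) j; rewrite dvec_e // !mxE.
  by under eq_bigr do rewrite mxE.
(* As [A] is a product of two invertible matrices, [Y *m cmx] is its two-sided inverse, to which the
   hypothesis on X applies. *)
have AB : A *m (Y *m cmx) = 1%:M.
  by rewrite /A mulmxA -[dmx *m _ *m _]mulmxA psiY mulmx1 dmx_cmx.
have BA : (Y *m cmx) *m A = 1%:M.
  by rewrite /A mulmxA -[Y *m _ *m _]mulmxA cmx_dmx mulmx1 Ypsi.
apply: (X_inv (x := fun i j => insubd 0 (A i j))) => i j.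
  have /matrixP/(_ i j) := AB; rewrite mxE [RHS]mxE => <-.
  by apply: eq_bigr => k _; rewrite insubdK.
have /matrixP/(_ i j) := BA; rewrite mxE [RHS]mxE => <-.
by apply: eq_bigr => k _; rewrite insubdK.
Qed.

Lemma sum_mulr_mem (s : seq 'I_M) (x y : 'I_M -> H) :
  (forall k, x k \in P) -> (forall k, y k \in P) ->
  \sum_(k <- s) x k * y k \in P.
Proof.
move=> xP yP.
suff -> : \sum_(k <- s) x k * y k =
    val (\sum_(k <- s) insubd (0 : X) (x k) * insubd 0 (y k)) by apply: valP.
by rewrite raddf_sum; apply: eq_bigr => k _; rewrite /= rmorphM /= !insubdK.
Qed.

Lemma dvec_cmx_mem a i : (dvec a *m cmx) 0 i \in P.
Proof.
have [B B_mem ->] := cmx_factor.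
rewrite mulmxA mxE; apply: sum_mulr_mem => k; last exact: B_mem.
exact: dvec_psi_mem.
Qed.

Lemma omega_mem i : (counit_row *m cmx) 0 i \in P.
Proof.
have [B B_mem ->] := cmx_factor.
rewrite mulmxA mxE; apply: sum_mulr_mem => k; last exact: B_mem.
(* With C = ψ^T B, only ε(b) ψ^T has to be examined, and the counit axiom identifies it with the row
   of the b^k. *)
suff -> : (counit_row *m Psi^T) 0 k = val (b k) by apply: valP.
by rewrite mxE -counit_psi; apply: eq_bigr => j _; rewrite !mxE mulr_algl.
Qed.

(** The default 0 is never taken, by [dvec_cmx_mem]. *)
Definition partialX (i : 'I_M) (a : X) : X := insubd 0 ((dvec a *m cmx) 0 i).

Lemma val_partialX i a : val (partialX i a) = (dvec a *m cmx) 0 i.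
Proof. by rewrite insubdK // dvec_cmx_mem. Qed.

(** The Leibniz rule forces de^j a = d(e^j a) - e^j da. Taking the coordinates of the right-hand
    side keeps them in X; [val_right_coef] identifies them with D F(a) C. *)
Definition right_coef (a : X) (j i : 'I_M) : X :=
  partialX i (e j * a) - e j * partialX i a.

Lemma val_right_coef a j i : val (right_coef a j i) = (dmx *m fmx a *m cmx) j i.
Proof.
rewrite rmorphB rmorphM /= !val_partialX dvecM // mulmxDl -scalemxAl dvec_e //.
rewrite mxE [X in _ + X - _]mxE addrK -!row_mul.
by rewrite mxE.
Qed.

Lemma partialX_linear i : linear (partialX i).
Proof.
move=> k x y; apply: val_inj; rewrite linearP /= !val_partialX dvec_linear.
by rewrite mulmxDl -scalemxAl !mxE mulr_algl.
Qed.

Lemma right_coef_linear j i : linear (fun a => right_coef a j i).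
Proof.
move=> k x y; rewrite /right_coef mulrDr -scalerAr !partialX_linear.
by rewrite scalerBr mulrDr opprD addrACA -scalerAr.
Qed.

(** * The bimodule: a free left X-module on M generators *)

Let G : lmodType K := {ffun 'I_M -> X}.

Definition left_mul (a : X) (g : G) : G := [ffun i => a * g i].
Definition right_mul (g : G) (a : X) : G :=
  [ffun i => \sum_j g j * right_coef a j i].
(** This embeds coordinates into H^M, where the bimodule axioms become matrix identities over H. *)
Definition row_val (g : G) : 'rV[H]_M := \row_i val (g i).

Lemma row_val_inj : injective row_val.
Proof.
by move=> f g /rowP fg; apply/ffunP => i; apply: val_inj; have := fg i; rewrite !mxE.
Qed.

Lemma left_mul_bilinear : bilinear_for *:%R *:%R left_mul.
Proof.
split=> [g|a] k x y; apply/ffunP => i; rewrite !ffunE.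
  by rewrite mulrDl scalerAl.
by rewrite mulrDr scalerAr.
Qed.

Lemma right_mul_bilinear : bilinear_for *:%R *:%R right_mul.
Proof.
split=> [a|g] k x y; apply/ffunP => i; rewrite !ffunE scaler_sumr -big_split;
  apply: eq_bigr => j _ /=; first by rewrite !ffunE mulrDl scalerAl.
by rewrite right_coef_linear mulrDr scalerAr.
Qed.

Lemma row_val_left_mul a g : row_val (left_mul a g) = val a *: row_val g.
Proof. by apply/rowP => i; rewrite !mxE ffunE rmorphM. Qed.

Lemma row_val_right_mul g a :
  row_val (right_mul g a) = row_val g *m (dmx *m fmx a *m cmx).
Proof.
apply/rowP => i; rewrite [LHS]mxE [RHS]mxE ffunE raddf_sum.
by apply: eq_bigr => j _ /=; rewrite rmorphM /= val_right_coef [row_val g _ _]mxE.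
Qed.

Definition calculus_bimodule : bimodule X.
Proof.
pose lB := bilinear_isBilinear.Build K X G G *:%R *:%R left_mul left_mul_bilinear.
pose l : {bilinear X -> G -> G} := HB.pack left_mul lB.
pose rB := bilinear_isBilinear.Build K G X G *:%R *:%R right_mul right_mul_bilinear.
pose rr : {bilinear G -> X -> G} := HB.pack right_mul rB.
apply: (@Bimodule K X G l rr) => /=.
- by move=> g; apply/ffunP => i; rewrite ffunE mul1r.
- by move=> x y g; apply/ffunP => i; rewrite !ffunE mulrA.
- move=> g; apply: row_val_inj.
  by rewrite row_val_right_mul fmx1 mulmx1 dmx_cmx mulmx1.
- move=> x y g; apply: row_val_inj.
  rewrite !row_val_right_mul fmxM -[RHS]mulmxA; congr (_ *m _).
  by rewrite !mulmxA cmx_dmxK.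
move=> x y g; apply: row_val_inj.
by rewrite !(row_val_right_mul, row_val_left_mul) scalemxAl.
Defined.

(** * The differential, its coefficients and the element ω *)

Definition differential (a : X) : G := [ffun i => partialX i a].

Lemma row_val_differential a : row_val (differential a) = dvec a *m cmx.
Proof. by apply/rowP => i; rewrite mxE ffunE val_partialX. Qed.

Lemma differential_linear : linear differential.
Proof.
by move=> k x y; apply/ffunP => i; rewrite !ffunE partialX_linear.
Qed.

Lemma differential_e i j : differential (e i) j = (i == j)%:R.
Proof.
apply: val_inj; rewrite ffunE val_partialX dvec_e // -row_mul dmx_cmx !mxE.
by rewrite rmorph_nat.
Qed.

Lemma sum_left_mul_e (c : 'I_M -> X) :
  \sum_i left_mul (c i) (differential (e i)) = [ffun i => c i].
Proof.
apply/ffunP => j; rewrite sum_ffunE ffunE.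
under eq_bigr do rewrite ffunE differential_e.
exact: sum_deltar.
Qed.

Lemma differentialM x y : differential (x * y) =
  right_mul (differential x) y + left_mul x (differential y).
Proof.
apply: row_val_inj; rewrite row_val_differential dvecM // mulmxDl.
have row_valD g h : row_val (g + h) = row_val g + row_val h.
  by apply/rowP => i; rewrite !mxE ffunE raddfD.
rewrite row_valD row_val_right_mul row_val_left_mul !row_val_differential.
rewrite -scalemxAl; congr (_ + _).
by rewrite !mulmxA cmx_dmxK.
Qed.

Definition calculus : fodc X.
Proof.
pose dL := GRing.isLinear.Build K X G *:%R differential differential_linear.
pose d : {linear X -> G} := HB.pack differential dL.
apply: (@FODC K X calculus_bimodule d differentialM) => g /=.
exists [seq (g i, e i) | i <- enum 'I_M].
rewrite big_map big_enum /=.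
by rewrite [RHS](sum_left_mul_e g); apply/ffunP => i; rewrite ffunE.
Defined.

Lemma calculus_unique_coefs : unique_coefs e calculus.
Proof.
move=> a; exists (differential a); split.
  by rewrite [RHS](sum_left_mul_e (differential a)); apply/ffunP => i; rewrite [RHS]ffunE.
move=> c E; rewrite [LHS]E [LHS](sum_left_mul_e c).
by apply/ffunP => i; rewrite ffunE.
Qed.

Lemma calculus_partial_coefs :
  partial_coefs X_coideal r e b pi nu calculus.
Proof.
move=> a; exists (partialX^~ a); split.
  by move=> i; rewrite partialE val_partialX.
by rewrite [RHS](sum_left_mul_e (partialX^~ a)).
Qed.

(** The coordinates of ω are ε(b) C. Under the right action D F(a) C the factor C D cancels, and
    what remains is [dvecE] multiplied by C. *)
Lemma calculus_inner : inner_by_omega r e b pi nu calculus.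
Proof.
pose w i : X := insubd 0 ((counit_row *m cmx) 0 i).
have wE i : val (w i) = (counit_row *m cmx) 0 i by rewrite insubdK // omega_mem.
exists w; split=> [i|]; first by rewrite omega_coefE wE.
rewrite /= => a; rewrite [\sum_i _](sum_left_mul_e w).
have row_valB g h : row_val (g - h) = row_val g - row_val h.
  by apply/rowP => i; rewrite !mxE !ffunE raddfB.
have row_w : row_val [ffun i => w i] = counit_row *m cmx.
  by apply/rowP => i; rewrite mxE ffunE wE.
apply: row_val_inj; rewrite [LHS]row_val_differential row_valB.
rewrite [X in _ = X - _]row_val_right_mul [X in _ = _ - X]row_val_left_mul row_w dvecE //.
by rewrite mulmxBl -scalemxAl !mulmxA cmx_dmxK.
Qed.

(** * Covariance *)

Lemma comul_partialX i a : comul (val (partialX i a)) =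
  \sum_l \sum_(q <- repr (lcoact a))
    (q.1 * antipode (pi l i)) ⊗ val (partialX l q.2).
Proof.
rewrite val_partialX mxE linear_sum.
(* The row d(a) is covariant, while the columns of C transform by S(π), as π is a
   corepresentation. *)
have cmx_comul k : comul (cmx k i) = \sum_l antipode (pi l i) ⊗ cmx k l.
  rewrite mxE linear_sum.
  under [RHS]eq_bigr do rewrite mxE linear_sumr.
  rewrite exchange_big; apply: eq_bigr => j _ /=.
  have := comul_antipode j i pi_corep; rewrite mxE linearZ_LR => ->.
  rewrite scaler_sumr; apply: eq_bigr => l _.
  by rewrite !mxE linearZr_LR.
under eq_bigr => k _ do rewrite comul_multiplicative cmx_comul mxE
  (comul_convX X_coideal p _ (@chi_scalar k)) mulr_sumr.
rewrite exchange_big; apply: eq_bigr => l _ /=.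
under eq_bigr do (rewrite mulr_suml; under eq_bigr do rewrite tensorM).
rewrite exchange_big; apply: eq_bigr => q _ /=.
rewrite val_partialX mxE linear_sumr.
by apply: eq_bigr => k _; rewrite [dvec _ _ _]mxE.
Qed.

(** Multiplication by π cancels the S(π) of [comul_partialX]. The equation is the de^m-component of
    the statement that da is sent to a_(1) ⊗ da_(2). *)
Lemma sum_lcoact_partialX m a :
  \sum_i lcoact (partialX i a) * (pi i m ⊗ 1) =
  \sum_(q <- repr (lcoact a)) q.1 ⊗ partialX m q.2.
Proof.
pose s := [seq (l, q) | l <- index_enum 'I_M, q <- repr (lcoact a)].
have lE i : lcoact (partialX i a) = \sum_l \sum_(q <- repr (lcoact a))
    (q.1 * antipode (pi l i)) ⊗ partialX l q.2.
  rewrite (@lcoact_eq _ _ _ _ X_coideal p pK _ s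
    (fun z => z.2.1 * antipode (pi z.1 i)) (fun z => partialX z.1 z.2.2)).
    by rewrite big_allpairs.
  by rewrite comul_partialX big_allpairs.
under eq_bigr do (rewrite lE mulr_suml;
  under eq_bigr do (rewrite mulr_suml; under eq_bigr do rewrite tensorM mulr1 -mulrA)).
rewrite exchange_big /=; under eq_bigr do rewrite exchange_big.
rewrite exchange_big; apply: eq_bigr => q _ /=.
under eq_bigr do rewrite -linear_sumlz -mulr_sumr.
have pi_mulV l : \sum_i antipode (pi l i) * pi i m = (l == m)%:R.
  have := corep_mulVE l m pi_corep => <-.
  by apply: eq_bigr => i _; rewrite !mxE.
under eq_bigr do rewrite pi_mulV.
rewrite (bigD1 m) //= eqxx mulr1 big1 ?addr0 // => l /negbTE ->.
by rewrite mulr0 linear0l.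
Qed.

Lemma calculus_covariant : covariant X_coideal calculus.
Proof.
pose f m (h : H) (x : X) : tensor H G := h ⊗ left_mul x (differential (e m)).
have f_bil m : bilinear_for *:%R *:%R (f m).
  split=> [x|h] k u v; rewrite /f /=; first exact: tensorPl.
  rewrite (left_mul_bilinear.1 _ k u v) /=; exact: tensorPr.
(* Covariance forces x de^i to go to the sum over m of x_(1) π^i_m ⊗ x_(2) de^m; since the de^i form
   a basis, this can serve as a definition. *)
pose D (g : G) : tensor H G :=
  \sum_m tensor_lift (f m) (\sum_i lcoact (g i) * (pi i m ⊗ 1)).
have D_lin : linear D.
  move=> k g g'; rewrite /D scaler_sumr -big_split; apply: eq_bigr => m _ /=.
  rewrite -(tensor_lift_is_linear (f_bil m)); congr (tensor_lift _ _).
  rewrite scaler_sumr -big_split; apply: eq_bigr => i _ /=.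
  by rewrite !ffunE (lcoact_linear X_coideal pK) mulrDl tensor_scalerAl.
pose DL := GRing.isLinear.Build K G (tensor H G) *:%R D D_lin.
pose DD : {linear G -> tensor H G} := HB.pack D DL.
exists DD => x y; rewrite [LHS]/(D (left_mul x (differential y))) /D.
pose s := [seq (q, t) | q <- repr (lcoact x), t <- repr (lcoact y)].
have lE m : \sum_i lcoact (left_mul x (differential y) i) * (pi i m ⊗ 1) =
    \sum_(z <- s) (z.1.1 * z.2.1) ⊗ (z.1.2 * partialX m z.2.2).
  under eq_bigr do rewrite !ffunE (lcoactM X_coideal pK) -mulrA.
  rewrite -mulr_sumr sum_lcoact_partialX [lcoact x in LHS]tensor_sumE.
  rewrite big_allpairs mulr_suml; apply: eq_bigr => q _.
  by rewrite mulr_sumr; apply: eq_bigr => t _; rewrite tensorM.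
under eq_bigr do rewrite lE tensor_lift_sum //.
rewrite exchange_big big_allpairs; apply: eq_bigr => q _; apply: eq_bigr => t _ /=.
rewrite -linear_sumr; congr (_ ⊗ _); rewrite /lact /=.
apply/ffunP => j; rewrite sum_ffunE.
under eq_bigr do rewrite ffunE differential_e.
by rewrite sum_deltar; apply/esym; rewrite ffunE; congr (_ * _); rewrite ffunE.
Qed.

(** * Uniqueness *)

Lemma calculus_uniqueness (G' : fodc X) :
  unique_coefs e G' -> partial_coefs X_coideal r e b pi nu G' ->
  fodc_iso calculus G'.
Proof.
move=> G'_unique G'_partial.
(* This is the only left linear map that sends each de^i to its counterpart in [G']. *)
pose f (g : G) : G' := \sum_i lact (g i) (diff G' (e i)).
have f_lin : linear f.
  move=> k g h; rewrite /f scaler_sumr -big_split; apply: eq_bigr => i _ /=.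
  by rewrite !ffunE linearPl.
pose fL := GRing.isLinear.Build K G G' *:%R f f_lin.
pose F : {linear G -> G'} := HB.pack f fL.
have f_sum (s : seq (X * X)) (E : X * X -> G) :
    f (\sum_(q <- s) E q) = \sum_(q <- s) f (E q) by exact: (linear_sum F).
have f_left a g : f (left_mul a g) = lact a (f g).
  rewrite /f linear_sumr; apply: eq_bigr => i _ /=.
  by rewrite ffunE lactM.
have f_diff a : f (differential a) = diff G' a.
  have [c [cE ->]] := G'_partial a; apply: eq_bigr => i _; congr (lact _ _).
  by apply: val_inj; rewrite ffunE cE partialE val_partialX.
have f_right_diff x y a : f (right_mul (left_mul x (differential y)) a) =
    ract (f (left_mul x (differential y))) a.
  have -> : right_mul (left_mul x (differential y)) a =
      left_mul x (right_mul (differential y) a).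
    exact: (@lractA _ _ calculus).
  rewrite !f_left f_diff lractA; congr (lact _ _).
  (* Right linearity on differentials follows by comparing the Leibniz rules of the two calculi,
     since f already respects d and the left action. *)
  have := diffM G' y a; rewrite -[in LHS]f_diff differentialM.
  rewrite [f _](linearD F) [F (left_mul _ _)]f_left f_diff.
  by move/addIr.
exists F; split=> //=.
- have f_inj : injective f.
    move=> g h gh; have [c [_ c_uniq]] := G'_unique 0.
    have c_eq0 (k : G) : f k = 0 -> k = c.
      by move=> k0; apply/esym/c_uniq; rewrite linear0 -[LHS]k0.
    apply/eqP; rewrite -subr_eq0; apply/eqP.
    rewrite (c_eq0 (g - h)); last by rewrite [LHS](linearB F) /= gh subrr.
    by apply/esym/c_eq0; rewrite [LHS](linear0 F).
  have f_surj y : exists g, f g = y.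
    have [s ->] := fodc_span y.
    exists (\sum_(q <- s) left_mul q.1 (differential q.2)).
    rewrite f_sum; apply: eq_bigr => q _ /=.
    by rewrite f_left f_diff.
  exists (fun y => projT1 (cid (f_surj y))) => y; last by case: cid.
  by apply: f_inj; case: cid.
- move=> g a; have [s ->] := @fodc_span _ _ calculus g.
  transitivity (f (\sum_(q <- s) right_mul (left_mul q.1 (differential q.2)) a)).
    by congr f; apply: (linear_sumlz (@ract _ _ calculus)).
  rewrite f_sum [f (\sum_(q <- s) _)]f_sum linear_sumlz.
  by apply: eq_bigr => q _; apply: f_right_diff.
Qed.

End Calculus.

Theorem theorem3 (R : realType) (H : hopfAlgType R[i])
  (r : {scalar tensor H H}) (r_univ : universal_rform r)
  (P : pred H) (X : subAlgType P)
  (X_coideal : left_coideal X) (X_inv : matrix_inverse_closed X)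
  (M : nat)
  (e : 'I_M -> X) (pi : 'I_M -> 'I_M -> H)
  (e_comul : forall i, comul (val (e i)) = \sum_j pi i j ⊗ val (e j))
  (b : 'I_M -> X) (psi : 'I_M -> 'I_M -> H)
  (b_comul : forall i, comul (val (b i)) = \sum_j psi i j ⊗ val (b j))
  (nu : {lrmorphism X -> X})
  (nu_covariant : forall a : X, lcoact X_coideal (nu a) =
     \sw_(a1, a2 <- lcoact X_coideal a) (a1 ⊗ nu a2))
  (chi_unit : chi_mx r e b nu \in unitmx) :
  exists G : fodc X,
    [/\ covariant X_coideal G,
        unique_coefs e G,
        partial_coefs X_coideal r e b pi nu G,
        inner_by_omega r e b pi nu G
      & forall G' : fodc X,
          covariant X_coideal G' -> unique_coefs e G' ->
          partial_coefs X_coideal r e b pi nu G' -> fodc_iso G G'].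
Proof.
(* The retraction p extends functionals on X to H, which lets chi and the [psi_form] be convolved
   with comul. *)
have [p pK] := linear_retraction (i := val : {linear X -> H}) val_inj.
exists (calculus r_univ X_inv e_comul b_comul nu_covariant chi_unit pK); split.
- exact: calculus_covariant.
- exact: calculus_unique_coefs.
- exact: calculus_partial_coefs.
- exact: calculus_inner.
- by move=> G' _; apply: calculus_uniqueness.
Qed.
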